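(* Let $\tau$ be a permutation of size $n\ge 1$. Then there exists a permutation $\pi$ of size $n$ with $T(\pi)=\tau$ if and only if every pair $(R_i,R_{i+1})$ of adjacent runs of $\tau$ satisfies $\min(R_i)<\max(R_{i+1})$.
   Context: Permutations are written in one-line notation $\pi=a_1a_2\ldots a_n$. A descent is an index $i$ with $a_i>a_{i+1}$, an ascent an index $i$ with $a_i<a_{i+1}$. The descents split $\pi$ into runs (maximal increasing strings of consecutive entries) and the ascents split $\pi$ into falls (maximal decreasing strings of consecutive entries). The flip $T$ is the map sending a permutation $\pi$ to the permutation obtained by reversing every fall of $\pi$ in place (e.g. $T(3276145)=2316745$). A permutation in the image of $T$ is called pop-stacked. A pair of adjacent runs $(R_i,R_{i+1})$ with $\min(R_i)<\max(R_{i+1})$ is called overlapping. *)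

(* Defs.v *)
From HB Require Import structures.
From mathcomp Require Import all_boot all_fingroup.

Set Implicit Arguments.
Unset Strict Implicit.
Unset Printing Implicit Defensive.

(* [blocks r s] cuts [s] between consecutive entries x, y with [~~ r x y], i.e.
   into its maximal [r]-chains of consecutive entries; see [blocksK],
   [blocks_sorted] and [blocks_maximal]. *)
Fixpoint blocks (A : Type) (r : rel A) (s : seq A) : seq (seq A) :=
  if s is x :: s' then
    match blocks r s' with
    | (y :: b) :: bs =>
        if r x y then (x :: y :: b) :: bs else [:: x] :: (y :: b) :: bs
    | bs => [:: x] :: bs
    end
  else [::].

Definition ord_lt (n : nat) : rel 'I_n := fun i j => i < j.
Definition ord_gt (n : nat) : rel 'I_n := fun i j => j < i.

(* Positions and values are numbered 0, ..., n-1 instead of 1, ..., n. *)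
Definition oneline (n : nat) (p : 'S_n) : seq 'I_n := [seq p i | i <- enum 'I_n].

Definition runs (n : nat) (p : 'S_n) : seq (seq 'I_n) :=
  blocks (@ord_lt n) (oneline p).

Definition falls (n : nat) (p : 'S_n) : seq (seq 'I_n) :=
  blocks (@ord_gt n) (oneline p).

Definition flip_word (n : nat) (p : 'S_n) : seq 'I_n :=
  flatten [seq rev F | F <- falls p].

(* The neutral element n exceeds every value, so this is the minimum of any
   nonempty R. *)
Definition min_entry (n : nat) (R : seq 'I_n) : nat :=
  \big[minn/n]_(x <- R) (x : nat).

Definition max_entry (n : nat) (R : seq 'I_n) : nat :=
  \max_(x <- R) (x : nat).

Definition overlapping (n : nat) (R S : seq 'I_n) : bool :=
  min_entry R < max_entry S.

Section BlocksFacts.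
Variables (A : eqType) (r : rel A).
Implicit Types (s : seq A).

Lemma blocks_nonempty s : [::] \notin blocks r s.
Proof.
elim: s => //= x s; case: (blocks r s) => [|[|y b] bs] //=.
by case: ifP => _; rewrite !inE //= => ->.
Qed.

Lemma blocksK s : flatten (blocks r s) = s.
Proof.
elim: s => //= x s; case: (blocks r s) => [|[|y b] bs] //= <- //.
by case: ifP.
Qed.

Lemma blocks_sorted s : all (sorted r) (blocks r s).
Proof.
elim: s => //= x s; case: (blocks r s) => [|[|y b] bs] //=.
by case: ifP => /= [-> //|_ /andP[-> ->]].
Qed.

Lemma blocks_maximal (a : A) s i : i.+1 < size (blocks r s) ->
  ~~ r (last a (nth [::] (blocks r s) i)) (head a (nth [::] (blocks r s) i.+1)).
Proof.
elim: s i => [//|x s IH] i /=.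
have := blocks_nonempty s.
case: (blocks r s) IH => [|[|y b] bs] //= IH _.
case: ifP => rxy; case: i => [|i] /= hi; first exact: (IH 0 hi).
- exact: (IH i.+1 hi).
- by rewrite rxy.
- exact: (IH i hi).
Qed.

Lemma perm_flatten_rev (ss : seq (seq A)) :
  perm_eq (flatten [seq rev b | b <- ss]) (flatten ss).
Proof. by elim: ss => //= b ss IH; apply: perm_cat; rewrite ?perm_rev. Qed.

End BlocksFacts.

Lemma flip_word_perm (n : nat) (p : 'S_n) : perm_eq (flip_word p) (oneline p).
Proof. by rewrite (perm_trans (perm_flatten_rev _)) // /falls blocksK. Qed.

Lemma size_flip_word (n : nat) (p : 'S_n) : size (flip_word p) = n.
Proof. by rewrite (perm_size (flip_word_perm p)) size_map size_enum_ord. Qed.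

Lemma flip_word_uniq (n : nat) (p : 'S_n) : uniq (flip_word p).
Proof.
rewrite (perm_uniq (flip_word_perm p)) map_inj_uniq ?enum_uniq //.
exact: perm_inj.
Qed.

Lemma flip_subproof (n : nat) (p : 'S_n) :
  injective (fun i : 'I_n => nth i (flip_word p) i).
Proof.
move=> i j /eqP; rewrite (set_nth_default i) ?size_flip_word //.
rewrite nth_uniq ?size_flip_word ?flip_word_uniq // => /eqP; exact: val_inj.
Qed.

(* [flip p] is the permutation whose one-line notation is [flip_word p]; see
   [oneline_flip]. *)
Definition flip (n : nat) (p : 'S_n) : 'S_n := perm (@flip_subproof n p).

Lemma oneline_flip (n : nat) (p : 'S_n) : oneline (flip p) = flip_word p.
Proof.
case: n p => [|n] p.
  have nil0 (s : seq 'I_0) : s = [::] by case: s => [//|[]].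
  by rewrite (nil0 (oneline _)) (nil0 (flip_word _)).
apply: (@eq_from_nth _ ord0) => [|i].
  by rewrite size_flip_word size_map size_enum_ord.
rewrite size_map size_enum_ord => hi.
rewrite (nth_map ord0) ?size_enum_ord // permE nth_enum_ord //.
by apply: set_nth_default; rewrite size_flip_word.
Qed.

Example reverse_falls_3276145 :
  flatten [seq rev F | F <- blocks (fun x y => y < x) [:: 3; 2; 7; 6; 1; 4; 5]]
  = [:: 2; 3; 1; 6; 7; 4; 5].
Proof. by []. Qed.

(* Main.v *)
Require Import Defs.
From mathcomp Require Import all_boot all_fingroup.

Set Implicit Arguments.
Unset Strict Implicit.
Unset Printing Implicit Defensive.

(** Reversing the runs of an overlapping [tau] produces a permutation whose
    falls are exactly the reversed runs, because the overlap condition says that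
    consecutive reversed runs are separated by an ascent; flipping it gives back
    [tau]. Conversely the falls of [pi], once reversed, are increasing blocks
    whose consecutive members overlap, and each run of [flip pi] is a
    concatenation of such blocks; merging blocks can only lower the minimum and
    raise the maximum, so adjacent runs still overlap. *)

Section Blocks.
Variables (A : eqType) (r : rel A).
Implicit Types (a x y : A) (b c s : seq A) (bs cs : seq (seq A)).

(** [blocks] is computed from the right, so a chain put in front of [s] can only affect the first
    block, at the junction. *)
Lemma blocks_cat x b y c s cs :
    path r x b -> blocks r s = (y :: c) :: cs ->
  blocks r ((x :: b) ++ s) =
    if r (last x b) y then ((x :: b) ++ y :: c) :: cs
    else (x :: b) :: (y :: c) :: cs.
Proof.
move=> + Es; elim: b x => [|z b IH] x /=; first by rewrite Es.
move=> /andP[rxz pzb]; have /= -> := IH z pzb.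
by case: ifP => _; rewrite /= rxz.
Qed.

Lemma blocks_chain x b : path r x b -> blocks r (x :: b) = [:: x :: b].
Proof.
elim: b x => [//|z b IH] x /= /andP[rxz pzb].
by have /= -> := IH z pzb; rewrite rxz.
Qed.

(** This identifies the reversed runs as the falls of a permutation: no chain crosses a junction
    where [r] fails. *)
Lemma blocks_flatten a bs :
    [::] \notin bs -> all (sorted r) bs ->
    sorted (fun b c => ~~ r (last a b) (head a c)) bs ->
  blocks r (flatten bs) = bs.
Proof.
elim: bs => [//|[//|x b] [|[//|y c] bs] IH].
  by move=> _ /andP[pxb _] _; rewrite /= cats0; exact: blocks_chain.
rewrite in_cons => /= bs0 /andP[pxb sbs] /andP[nr pbs].
have Es := IH bs0 sbs pbs.
by have /= -> := blocks_cat pxb Es; rewrite (negbTE nr).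
Qed.

Lemma blocks_separated a s :
  sorted (fun b c => ~~ r (last a b) (head a c)) (blocks r s).
Proof. by apply/(sortedP [::]) => i; exact: blocks_maximal. Qed.

(** Makes strict the weak inequality that the maximality of falls gives at their junctions. *)
Lemma uniq_flatten_separated a bs : [::] \notin bs -> uniq (flatten bs) ->
  sorted (fun b c => last a b != head a c) bs.
Proof.
elim: bs => [//|[//|x b] [//|[//|y c] bs] IH].
rewrite in_cons => bs0.
rewrite -[flatten _]/((x :: b) ++ flatten ((y :: c) :: bs)) cat_uniq => /and3P[_ /hasPn dis Us].
have /= -> := IH bs0 Us; rewrite andbT; apply/negP => /eqP E.
by have /negP[] := dis y (mem_head _ _); rewrite -E mem_last.
Qed.

Hypothesis r_trans : transitive r.

(* The second conjunct strengthens the induction: the first block of the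
   coarser decomposition starts with the first block of [bs]. *)
Lemma blocks_flatten_overlap_ind a bs :
    [::] \notin bs -> all (sorted r) bs ->
    sorted (fun b c => r (head a b) (last a c)) bs ->
  sorted (fun b c => r (head a b) (last a c)) (blocks r (flatten bs)) /\
  forall z, r z (last a (head [::] bs)) ->
    r z (last a (head [::] (blocks r (flatten bs)))).
Proof.
elim: bs => [//|[//|x b] [|d bs] IH].
  by move=> _ /andP[pxb _] _; rewrite /= cats0; have /= -> := blocks_chain pxb.
rewrite in_cons => /= bs0 /andP[pxb sbs] /andP[oxd pbs].
have [] := IH bs0 sbs pbs.
have := blocks_nonempty r (d ++ flatten bs).
have := blocks_sorted r (d ++ flatten bs).
case Es: (blocks r (d ++ flatten bs)) => [|[//|y c] cs].
  have := blocksK r (d ++ flatten bs).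
  by move: bs0; rewrite Es in_cons; case: (d).
move=> /= /andP[pyc _] _ pcs hlast.
(* Without a merge, [x] must be compared with the end of the block starting at [y], which may extend
   beyond [d]; [hlast] carries [oxd] over to it. *)
have /= -> := blocks_cat pxb Es; case: ifP => rby /=; last first.
  by split=> //; rewrite pcs andbT; exact: hlast.
(* For empty [b] this is [rby]; otherwise go through the last entry of [b]. *)
have rxy: r x y.
  have := order_path_min r_trans pxb.
  move: rby; case: (lastP b) => //= b' t; rewrite last_rcons all_rcons.
  by move=> rty /andP[rxt _]; exact: r_trans rxt rty.
split.
  case: cs pcs {Es} => //= e cs /andP[rye ->]; rewrite andbT.
  exact: r_trans rxy rye.
(* Climb from [z] to the end of [b], across the junction to [y], then along [c]. *)
move=> z rzb; rewrite last_cat /=.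
have rzy := r_trans rzb rby.
case: (lastP c) pyc => //= c' t; rewrite last_rcons.
move=> /(order_path_min r_trans); rewrite all_rcons => /andP[ryt _].
exact: r_trans rzy ryt.
Qed.

Lemma blocks_flatten_overlap a bs :
    [::] \notin bs -> all (sorted r) bs ->
    sorted (fun b c => r (head a b) (last a c)) bs ->
  sorted (fun b c => r (head a b) (last a c)) (blocks r (flatten bs)).
Proof. by move=> bs0 sbs obs; have [] := blocks_flatten_overlap_ind bs0 sbs obs. Qed.

End Blocks.

Lemma head_rev (A : Type) (a : A) s : head a (rev s) = last a s.
Proof. by case: (lastP s) => // s' x; rewrite rev_rcons last_rcons. Qed.

Lemma last_rev (A : Type) (a : A) s : last a (rev s) = head a s.
Proof. by rewrite -head_rev revK. Qed.

Lemma nil_notin_map_rev (A : eqType) (bs : seq (seq A)) :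
  ([::] \notin [seq rev b | b <- bs]) = ([::] \notin bs).
Proof. by rewrite -[[::]]/(rev (Nil A)) mem_map //; exact: inv_inj revK. Qed.

Section Oneline.
Variable n : nat.
Implicit Types (p : 'S_n) (w R S : seq 'I_n).

Lemma ord_lt_trans : transitive (@ord_lt n).
Proof. by move=> y x z; exact: ltn_trans. Qed.

Lemma sorted_ord_gt_rev R : sorted (@ord_gt n) (rev R) = sorted (@ord_lt n) R.
Proof. by rewrite rev_sorted. Qed.

Lemma oneline_uniq p : uniq (oneline p).
Proof. by rewrite map_inj_uniq ?enum_uniq //; exact: perm_inj. Qed.

Lemma size_oneline p : size (oneline p) = n.
Proof. by rewrite size_map size_enum_ord. Qed.

Lemma oneline_inj : injective (@oneline n).
Proof.
move=> p q /eq_in_map pq; apply/permP => i.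
by apply: pq; rewrite mem_enum.
Qed.

Lemma oneline_surj w : uniq w -> size w = n -> exists p, oneline p = w.
Proof.
move=> Uw /eqP szw; have /tuple_uniqP w_inj : uniq (Tuple szw) by [].
exists (perm w_inj); rewrite /oneline (eq_map (permE w_inj)).
by rewrite map_tnth_enum.
Qed.

Lemma min_entry_sorted (x : 'I_n) R :
  path (@ord_lt n) x R -> min_entry (x :: R) = x.
Proof.
move/(order_path_min ord_lt_trans)/allP => xR; rewrite /min_entry big_cons.
apply/minn_idPl; rewrite big_seq.
(* The first case is the neutral element [n], above [x] because [x] is an ordinal. *)
elim/big_ind: _ => [|u v xu xv|y /xR/ltnW //]; first exact: ltnW.
by rewrite leq_min xu.
Qed.

Lemma max_entry_sorted (x : 'I_n) R :
  path (@ord_lt n) x R -> max_entry (x :: R) = last x R.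
Proof.
rewrite /max_entry; elim: R x => [|y R IH] x /=; first by rewrite big_seq1.
move=> /andP[xy pyR]; rewrite big_cons IH //; apply/maxn_idPr.
have := order_path_min ord_lt_trans pyR.
case: (lastP R) => [_|R' z]; first exact: ltnW.
rewrite last_rcons all_rcons => /andP[yz _].
exact: ltnW (ltn_trans xy yz).
Qed.

(** An increasing block has its minimum first and its maximum last; this links [overlapping] to the
    order-theoretic block lemmas. *)
Lemma overlapping_sorted a R S :
    R != [::] -> S != [::] -> sorted (@ord_lt n) R -> sorted (@ord_lt n) S ->
  overlapping R S = ord_lt (head a R) (last a S).
Proof.
case: R S => [|x R] [|y S] // _ _ sR sS.
by rewrite /overlapping min_entry_sorted // max_entry_sorted.
Qed.

Lemma sorted_overlapping a (bs : seq (seq 'I_n)) :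
    [::] \notin bs -> all (sorted (@ord_lt n)) bs ->
  sorted (@overlapping n) bs =
  sorted (fun R S => ord_lt (head a R) (last a S)) bs.
Proof.
move=> bs0 /allP sbs; apply: (@eq_in_sorted _ (mem bs)); last exact/allP.
by move=> R S Rbs Sbs; apply: overlapping_sorted; rewrite ?sbs //;
  apply: contraNneq bs0 => <-.
Qed.

Lemma runs_flip_overlapping a p :
  sorted (fun R S => ord_lt (head a R) (last a S)) (runs (flip p)).
Proof.
have F0 : [::] \notin falls p := blocks_nonempty _ _.
rewrite /runs oneline_flip; apply: blocks_flatten_overlap.
- exact: ord_lt_trans.
- by rewrite nil_notin_map_rev.
- rewrite all_map; apply: sub_all (blocks_sorted (@ord_gt n) (oneline p)) => F.
  by rewrite /= -sorted_ord_gt_rev revK.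
have UF : uniq (flatten (falls p)) by rewrite blocksK oneline_uniq.
(* After reversal, overlap says that the last entry of a fall is less than the first entry of the
   next: maximality gives the weak inequality, distinctness of entries the strict one. *)
rewrite sorted_map; apply/(sortedP [::]) => i ltiF.
have := sortedP [::] (uniq_flatten_separated a F0 UF) i ltiF.
have := sortedP [::] (blocks_separated (@ord_gt n) a (oneline p)) i ltiF.
rewrite /= head_rev last_rev /ord_gt /ord_lt -leqNgt ltn_neqAle => -> ne.
by rewrite andbT.
Qed.

Lemma overlapping_flip a p :
    sorted (fun R S => ord_lt (head a R) (last a S)) (runs p) ->
  exists q, flip q = p.
Proof.
move=> oR; have R0 : [::] \notin runs p := blocks_nonempty _ _.
have Ew := perm_flatten_rev (runs p); rewrite blocksK in Ew.
have [q Eq] : exists q, oneline q = flatten [seq rev R | R <- runs p].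
  apply: oneline_surj; first by rewrite (perm_uniq Ew) oneline_uniq.
  by rewrite (perm_size Ew) size_oneline.
exists q; apply: oneline_inj; rewrite oneline_flip /flip_word /falls Eq.
rewrite (@blocks_flatten _ _ a).
- by rewrite mapK ?blocksK //; exact: revK.
- by rewrite nil_notin_map_rev.
- rewrite all_map; apply: sub_all (blocks_sorted (@ord_lt n) (oneline p)) => R.
  by rewrite /= sorted_ord_gt_rev.
(* An ascent between [rev R] and [rev S] compares the head of [R] with the last entry of [S],
   exactly as overlap does. *)
rewrite sorted_map; apply: sub_sorted oR => R S /=.
by rewrite last_rev head_rev /ord_gt /ord_lt -leqNgt; exact: ltnW.
Qed.

End Oneline.

Theorem theorem3 (n : nat) (hn : 1 <= n) (tau : 'S_n) :
  (exists pi : 'S_n, flip pi = tau) <->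
  (forall i : nat, i.+1 < size (runs tau) ->
     overlapping (nth [::] (runs tau) i) (nth [::] (runs tau) i.+1)).
Proof.
(* A default for [head] and [last]; its value is immaterial since all blocks are nonempty. *)
pose a : 'I_n := Ordinal hn.
have Eo : sorted (@overlapping n) (runs tau) =
    sorted (fun R S => ord_lt (head a R) (last a S)) (runs tau).
  by apply: sorted_overlapping; [exact: blocks_nonempty|exact: blocks_sorted].
split=> [[p Ep]|/(sortedP [::])].
  by apply/(sortedP [::]); rewrite Eo -Ep; exact: runs_flip_overlapping.
by rewrite Eo; exact: overlapping_flip.
Qed.
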